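(* Let $p\ge1$ and $\Delta_1>0$, and for $\mu>0$ put $b_\mu^{\Delta_1}=\Delta_1/[-2\log\{2\Phi(-\mu/2)\}]$. (i) For any $\mu>0$ and $b>0$, the multivariate Laplace mechanism $M_{\mathrm{Lap}}(\cdot;b)$ is $\mu$-GDP for every statistic $\theta:\mathcal X^n\to\mathbb R^p$ with $\Delta_1(\theta;\mathcal X^n)\le\Delta_1$ if and only if $b\ge b_\mu^{\Delta_1}$. (ii) Conversely, for any $b>0$, $M_{\mathrm{Lap}}(\cdot;b)$ is $\mu$-GDP for every statistic $\theta:\mathcal X^n\to\mathbb R^p$ with $\Delta_1(\theta;\mathcal X^n)\le\Delta_1$ if and only if $\mu\ge-2\Phi^{-1}\left\{\frac12\exp\left(\frac{-\Delta_1}{2b}\right)\right\}$. (iii) Suppose $p\ge2$ (and let $\mu>0$). For any given $\theta$ with $\Delta_1(\theta;\mathcal X^n)\le\Delta_1$, $M_{\mathrm{Lap}}(\cdot;b)$ is $\mu$-GDP if $b\ge b_\mu^{\Delta_1}$. However, there exists $\theta$ such that $\Delta_1(\theta;\mathcal X^n)\le\Delta_1$ and $M_{\mathrm{Lap}}(\cdot;b)$ is $\mu$-GDP for some $b<b_\mu^{\Delta_1}$.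
   Context: $\mathcal X$ is a sample space with at least two elements and $n\ge1$ (so that neighboring data sets exist). $S,S'\in\mathcal X^n$ are neighbors ($S\sim S'$) if they differ in exactly one record. $\Delta_1(\theta;\mathcal X^n)=\sup_{S\sim S'}\|\theta(S)-\theta(S')\|_1$. $\mathrm{Lap}(\delta,b)$ is the Laplace distribution with location $\delta\in\mathbb R$ and scale $b>0$ (density $\frac1{2b}e^{-|x-\delta|/b}$); $\mathrm{Lap}_p(\delta,b)$, $\delta\in\mathbb R^p$, is the law of a vector with independent coordinates $X_i\sim\mathrm{Lap}(\delta_i,b)$. The multivariate Laplace mechanism for $\theta$ is $M_{\mathrm{Lap}}(S;b)=\theta(S)+\mathrm{Lap}_p(0,b)$, i.e. $\theta(S)$ plus a $\mathrm{Lap}_p(0,b)$ random vector. $\Phi$ is the standard normal distribution function. For distributions $P,Q$ on a common space, $T(P,Q)(\alpha)=\inf\{1-\mathbb E_Q\phi:\ \phi\text{ a }[0,1]\text{-valued measurable test},\ \mathbb E_P\phi\le\alpha\}$, $\alpha\in[0,1]$; for random elements $T(X,Y)$ is the trade-off function of their laws. $G_\mu(\alpha)=T(N(0,1),N(\mu,1))(\alpha)=\Phi(\Phi^{-1}(1-\alpha)-\mu)$. A mechanism $M$ is $\mu$-GDP if $\inf_{S\sim S'}T(M(S),M(S'))\ge G_\mu$ pointwise on $[0,1]$. *)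

(* Defs.v *)
From HB Require Import structures.
From mathcomp Require Import all_boot all_order all_algebra.
From mathcomp Require Import all_classical all_reals all_analysis.
From mathcomp Require Import measurable_realfun.

Set Implicit Arguments.
Unset Strict Implicit.
Unset Printing Implicit Defensive.

Import Order.TTheory GRing.Theory Num.Theory.
Import numFieldNormedType.Exports.

Local Open Scope classical_set_scope.
Local Open Scope ring_scope.

Definition laplace_pdf {R : realType} (m : R) (b : {posnum R}) (x : R) : R :=
  (2 * b%:num)^-1 * expR (- (`|x - m| / b%:num)).

Definition laplace_prob {R : realType} (m : R) (b : {posnum R}) :
    set (measurableTypeR R) -> \bar R :=
  fun A => (\int[lebesgue_measure]_(x in A) (laplace_pdf m b x)%:E)%E.

Section laplace_probability.
Context {R : realType} (m : R) (b : {posnum R}).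
Local Notation mu := (@lebesgue_measure R).

Lemma laplace_pdf_ge0 x : 0 <= laplace_pdf m b x.
Proof. by rewrite mulr_ge0 ?expR_ge0// invr_ge0 mulr_ge0. Qed.

Lemma continuous_laplace_pdf (c : R) : continuous (laplace_pdf c b).
Proof.
move=> x; apply: cvgMl_tmp; apply: continuous_comp; last exact: continuous_expR.
apply: cvgN; apply: cvgMr_tmp; apply: cvg_norm; apply: cvgB => //.
exact: cvg_cst.
Qed.

Lemma measurable_laplace_pdf : measurable_fun [set: R] (laplace_pdf m b).
Proof. by apply: continuous_measurable_fun; exact: continuous_laplace_pdf. Qed.

Let integral_laplace_pdf0 : (\int[mu]_x (laplace_pdf 0 b x)%:E = 1)%E.
Proof.
rewrite ge0_symfun_integralT; first last.
- by move=> x; rewrite /laplace_pdf /= !subr0 normrN.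
- exact: continuous_laplace_pdf.
- by move=> x; rewrite mulr_ge0 ?expR_ge0// invr_ge0 mulr_ge0.
have b0 : 0 < b%:num^-1 :> R by rewrite invr_gt0.
have /= := integral_exponential_pdf b0.
rewrite -[X in X = _ -> _]/(\int[mu]_x (exponential_pdf b%:num^-1 x)%:E)%E => E1.
transitivity (2%:E * \int[mu]_(x in [set x : R | (0 <= x)%R])
   ((2^-1)%:E * (exponential_pdf b%:num^-1 x)%:E))%E.
  congr (_ * _)%E; apply: eq_integral => x; rewrite inE /= => x0.
  rewrite exponential_pdfE// /laplace_pdf subr0 ger0_norm// -EFinM.
  by rewrite invfM mulrA mulNr (mulrC _ x).
have m0 : measurable [set x : R | 0 <= x] by rewrite -set_itvcy.
rewrite ge0_integralZl//=; last 2 first.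
- by apply/measurable_EFinP; apply: measurable_funTS;
    exact: measurable_exponential_pdf.
- by move=> x _; rewrite lee_fin exponential_pdf_ge0// ltW.
rewrite muleA -EFinM divff// mul1e -E1 integral_mkcond.
apply: eq_integral => x _; rewrite patchE; case: ifPn => //.
rewrite notin_setE /= => /negP; rewrite -ltNge => x0.
by rewrite lt0_exponential_pdf.
Qed.

Lemma integral_laplace_pdf : (\int[mu]_x (laplace_pdf m b x)%:E = 1)%E.
Proof.
rewrite -integral_laplace_pdf0.
have dF : (fun x : R => x - m)^`()%classic = cst 1.
  apply/funext => x; rewrite derive1E deriveB// derive_id derive_cst.
  by rewrite subr0.
rewrite (@increasing_ge0_integration_by_substitutionT _ (fun x : R => x - m)
  (laplace_pdf 0 b)).
- by apply: eq_integral => x _; rewrite dF /laplace_pdf /= !fctE /= subr0 mulr1.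
- by move=> x y xy; rewrite ltrD2r.
- by rewrite dF => ?; exact: cvg_cst.
- by rewrite dF; exact: is_cvg_cst.
- by rewrite dF; exact: is_cvg_cst.
- by move=> x.
- exact: cvg_addrr_Ny.
- exact: cvg_addrr.
- exact: continuous_laplace_pdf.
- by move=> x; rewrite mulr_ge0 ?expR_ge0// invr_ge0 mulr_ge0.
Qed.

Let laplace0 : laplace_prob m b set0 = 0%E.
Proof. by rewrite /laplace_prob integral_set0. Qed.

Let laplace_ge0 A : (0 <= laplace_prob m b A)%E.
Proof.
by rewrite /laplace_prob integral_ge0//= => x _; rewrite lee_fin laplace_pdf_ge0.
Qed.

Let laplace_sigma_additive : semi_sigma_additive (laplace_prob m b).
Proof.
have mEf : measurable_fun setT (EFin \o laplace_pdf m b).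
  by apply/measurable_EFinP; exact: measurable_laplace_pdf.
move=> /= A mA tA mUA.
rewrite /laplace_prob ge0_integral_bigcup//=.
- apply: is_cvg_ereal_nneg_natsum_cond => k _ _.
  by apply: integral_ge0 => /= x ?; rewrite lee_fin laplace_pdf_ge0.
- exact: measurable_funTS.
- by move=> x _; rewrite lee_fin laplace_pdf_ge0.
Qed.

HB.instance Definition _ := isMeasure.Build _ _ _
  (laplace_prob m b) laplace0 laplace_ge0 laplace_sigma_additive.

Let laplace_setT : laplace_prob m b [set: _] = 1%E.
Proof. by rewrite /laplace_prob integral_laplace_pdf. Qed.

HB.instance Definition _ :=
  @Measure_isProbability.Build _ _ R (laplace_prob m b) laplace_setT.

End laplace_probability.

Section product_law.
Context d (T : measurableType d) (R : realType).

Definition cons_pair n (xt : T * n.-tuple T) : n.+1.-tuple T :=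
  [tuple of xt.1 :: xt.2].

Let measurable_cons_pair n : measurable_fun setT (@cons_pair n).
Proof. exact: measurable_cons. Qed.

HB.instance Definition _ n :=
  isMeasurableFun.Build _ _ _ _ (@cons_pair n) (@measurable_cons_pair n).

(* Law of a vector with independent coordinates of laws [P i]; it is
   characterized by its values on boxes, see [product_law_box]. *)
Fixpoint product_law n : ('I_n -> probability T R) -> probability (n.-tuple T) R :=
  match n with
  | 0 => fun _ => \d_([tuple] : 0.-tuple T)
  | k.+1 => fun P =>
      distribution (P ord0 \x product_law (fun i => P (lift ord0 i)))%E
        (@cons_pair k)
  end.

Lemma measurable_box n (A : 'I_n -> set T) : (forall i, measurable (A i)) ->
  measurable [set t : n.-tuple T | forall i, A i (tnth t i)].
Proof.
move=> mA.
rewrite (_ : [set t | _] =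
    \bigcap_(i in [set: 'I_n]) ((fun t : n.-tuple T => tnth t i) @^-1` A i)).
  apply: fin_bigcap_measurable => // i _; rewrite -[X in measurable X]setTI.
  exact: measurable_tnth.
by apply/seteqP; split => t At i; [move=> _; exact: At|exact: (At i)].
Qed.

Lemma product_law_box n (P : 'I_n -> probability T R) (A : 'I_n -> set T) :
  (forall i, measurable (A i)) ->
  product_law P [set t | forall i, A i (tnth t i)] = (\prod_(i < n) P i (A i))%E.
Proof.
elim: n P A => [|n IH] P A mA /=.
  by rewrite big_ord0 diracE mem_set// => -[].
rewrite /distribution /pushforward /=.
rewrite (_ : _ @^-1` _ = A ord0 `*`
    [set t : n.-tuple T | forall i, A (lift ord0 i) (tnth t i)]).
  have mA' i : measurable (A (lift ord0 i)) by exact: mA.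
  have mB := measurable_box mA'.
  rewrite product_measure1E// big_ord_recl; congr (_ * _)%E.
  exact: IH.
apply/seteqP; split => -[x t] /=.
  by move=> H; split => [|i]; [have := H ord0|have := H (lift ord0 i)];
    rewrite ?tnth0 ?tnthS.
move=> [Ax At] i; have [j ->|->] := unliftP ord0 i; last by rewrite tnth0.
by rewrite tnthS.
Qed.

End product_law.

Section laplace_vector.
Context {R : realType} {p : nat}.

(* Laws on R^p live on [p.-tuple (measurableTypeR R)], the measurable type
   carrying [lebesgue_measure] and [normal_prob]; it is convertible to
   [p.-tuple R]. *)
Definition Lap_p (delta : p.-tuple R) (b : {posnum R}) :
    probability (p.-tuple (measurableTypeR R)) R :=
  product_law (fun i : 'I_p => laplace_prob (tnth delta i) b).

Definition add_tuple (u : p.-tuple R) (v : p.-tuple (measurableTypeR R)) :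
    p.-tuple (measurableTypeR R) :=
  [tuple tnth u i + (tnth v i : R) | i < p].

Let measurable_add_tuple (u : p.-tuple R) : measurable_fun setT (add_tuple u).
Proof.
apply/measurable_fun_tnthP => i.
rewrite (_ : _ \o _ = fun v => tnth u i + (tnth v i : R)); last first.
  by apply/funext => v /=; rewrite tnth_mktuple.
apply: (@measurable_funD _ _ _ _ (cst (tnth u i))) => //.
exact: measurable_tnth.
Qed.

HB.instance Definition _ (u : p.-tuple R) :=
  isMeasurableFun.Build _ _ _ _ (add_tuple u) (@measurable_add_tuple u).

Definition l1dist (u v : p.-tuple R) : R :=
  \sum_(i < p) `|tnth u i - tnth v i|.

End laplace_vector.

Section standard_normal.
Context {R : realType}.

Definition Phi (x : R) : R := fine (normal_prob 0 1 `]-oo, x]).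

(* Inverse of [Phi] on its range `]0, 1[; unspecified elsewhere. *)
Definition Phi_inv : R -> R := pinv [set: R] Phi.

End standard_normal.

Section tradeoff.
Context {R : realType}.
Local Open Scope ereal_scope.

Definition tradeoff d (T : measurableType d) (P Q : probability T R)
    (alpha : R) : \bar R :=
  ereal_inf [set 1 - 'E_Q[phi] | phi in
    [set phi : T -> R | [/\ measurable_fun setT phi,
                            forall x, (0 <= phi x <= 1)%R &
                            'E_P[phi] <= alpha%:E]]].

(* For [0 <= mu] this is [Phi (Phi_inv (1 - alpha) - mu)] on `]0, 1[. *)
Definition G (mu alpha : R) : \bar R :=
  tradeoff (normal_prob 0 1) (normal_prob mu 1) alpha.

End tradeoff.

Section privacy.
Context {R : realType} {X : Type} {n : nat}.
Local Open Scope ereal_scope.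

Definition neighbors (S S' : n.-tuple X) : Prop :=
  exists! i : 'I_n, tnth S i <> tnth S' i.

Definition Delta1 p (theta : n.-tuple X -> p.-tuple R) : \bar R :=
  ereal_sup [set r | exists S S', neighbors S S' /\
                                  r = (l1dist (theta S) (theta S'))%:E].

Definition GDP d (T : measurableType d) (mu : R)
    (M : n.-tuple X -> probability T R) : Prop :=
  forall alpha : R, (0 <= alpha <= 1)%R ->
    G mu alpha <= ereal_inf [set r | exists S S', neighbors S S' /\
                                     r = tradeoff (M S) (M S') alpha].

Definition M_Lap p (theta : n.-tuple X -> p.-tuple R) (b : {posnum R})
    (S : n.-tuple X) : probability (p.-tuple (measurableTypeR R)) R :=
  distribution (Lap_p [tuple 0%R | _ < p] b) (add_tuple (theta S)).

End privacy.

Definition b_mu {R : realType} (D mu : R) : R :=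
  D / (- 2 * ln (2 * Phi (- (mu / 2)))).

(* Main.v *)
From HB Require Import structures.
Require Import Defs.
From mathcomp Require Import all_boot all_order all_algebra.
From mathcomp Require Import all_classical all_reals all_analysis.
From mathcomp Require Import measurable_realfun ring lra.

Import Order.TTheory GRing.Theory Num.Theory.
Import numFieldNormedType.Exports.

Local Open Scope classical_set_scope.
Local Open Scope ring_scope.

Set Implicit Arguments.
Unset Strict Implicit.
Unset Printing Implicit Defensive.

(* Write F for the distribution function of Lap(0, 1). By Neyman-Pearson, a test
   of size at most F(x) under Lap(m, b) has power at most F(x + |m - m'| / b)
   under Lap(m', b); these bounds form a semigroup in the shift, so changing the
   coordinates one at a time gives F(x + |u - u'|_1 / b) for Lap_p(u, b) against
   Lap_p(u', b). With eps = D / b, mu-GDP thus reduces to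
   F(x + eps) <= Phi(s + mu) whenever F(x) = Phi(s), and log-concavity of Phi
   reduces this to the symmetric point x = - eps / 2, i.e. to
   Phi(- mu / 2) <= F(- eps / 2). That condition is necessary: shift the first
   coordinate by D and use the half-space test thresholded at D / 2.
   In (iii) a constant statistic is private at every noise level. *)

(** * Measure-preserving maps, densities and Neyman-Pearson on the line *)

Definition lebesgue_preserving {R : realType} (phi : R -> R) : Prop :=
  measurable_fun setT phi /\
  forall A : set R, measurable A ->
    lebesgue_measure (phi @^-1` A) = lebesgue_measure A.

(** The image of Lebesgue measure under a translation gives every half-open interval its length, and
    Lebesgue measure is the only measure that does. *)
Lemma lebesgue_preserving_shift {R : realType} (m : R) :
  lebesgue_preserving (+%R m).
Proof.
have mphi : measurable_fun setT (fun x : measurableTypeR R => m + x : measurableTypeR R).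
  exact: measurable_funD.
pose phi_mixin := isMeasurableFun.Build _ _ _ _ _ mphi.
pose phi : {mfun _ >-> _} :=
  HB.pack (fun x : measurableTypeR R => m + x : measurableTypeR R) phi_mixin.
split => // A mA; apply/esym.
apply: (@lebesgue_measure_unique R (pushforward lebesgue_measure phi)) => //.
move=> _ [[a b] _ <-]; rewrite /pushforward/=.
rewrite [X in _ = lebesgue_measure X](_ : _ = [set` `]a - m, b - m]]); last first.
  by apply/seteqP; split => x /=; rewrite !in_itv/= ltrBlDl lerBrDl.
rewrite !lebesgue_measure_itv/= !lte_fin ltrD2r -!EFinB; case: ifP => // _.
by congr EFin; ring.
Qed.

Lemma lebesgue_preserving_opp {R : realType} : lebesgue_preserving (@GRing.opp R).
Proof.
by split => [|A mA]; [exact: oppr_measurable|exact: (lebesgue_measureN mA)].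
Qed.

Lemma ge0_integral_preserving {R : realType} (phi : R -> R) (f : R -> \bar R) :
  lebesgue_preserving phi -> measurable_fun setT f -> (forall x, 0 <= f x)%E ->
  (\int[lebesgue_measure]_x f (phi x) = \int[lebesgue_measure]_x f x)%E.
Proof.
move=> [mphi phiE] mf f0.
have mphi' : measurable_fun setT (phi : measurableTypeR R -> measurableTypeR R) by [].
pose phi_mixin := isMeasurableFun.Build _ _ _ _ _ mphi'.
pose phiM : {mfun _ >-> _} :=
  HB.pack (phi : measurableTypeR R -> measurableTypeR R) phi_mixin.
have := @ge0_integral_pushforward _ _ _ _ R _ mphi' lebesgue_measure setT f measurableT mf.
rewrite preimage_setT => <-; last by move=> x _; exact: f0.
by apply: (@eq_measure_integral _ _ _ _ _ (pushforward lebesgue_measure phiM)) => A mA _;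
  exact: phiE.
Qed.

Definition has_density {R : realType} (P : probability (measurableTypeR R) R)
    (p : R -> R) : Prop :=
  [/\ measurable_fun setT p, forall x, 0 <= p x &
      forall A, measurable A -> P A = (\int[lebesgue_measure]_(x in A) (p x)%:E)%E].

(** [p] integrates to [P] on every measurable set, hence agrees almost everywhere with the
    Radon-Nikodym derivative of [P], to which the change of variables formula applies. *)
Lemma integral_density {R : realType} (P : probability (measurableTypeR R) R) (p : R -> R)
    (f : R -> \bar R) :
  has_density P p -> measurable_fun setT f -> (forall x, 0 <= f x)%E ->
  (\int[P]_x f x = \int[lebesgue_measure]_x (f x * (p x)%:E))%E.
Proof.
move=> [mp p0 PE] mf f0.
have Plam : (P : set _ -> \bar R) `<< lebesgue_measure.
  apply/null_content_dominatesP => A mA A0; rewrite PE//.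
  by apply: null_set_integral => //; exact/measurable_funTS/measurable_EFinP.
rewrite -(Radon_Nikodym_SigmaFinite.change_of_variables Plam)//.
apply: ae_eq_integral => //.
- apply: emeasurable_funM => //.
  exact: measurable_int (Radon_Nikodym_SigmaFinite.f_integrable Plam).
- by apply: emeasurable_funM => //; exact/measurable_EFinP.
apply: (@ae_eqe_mul2l _ _ _ lebesgue_measure).
apply: integral_ae_eq => //; first exact: Radon_Nikodym_SigmaFinite.f_integrable.
  exact/measurable_EFinP.
by move=> E _ mE; rewrite -PE// -Radon_Nikodym_SigmaFinite.f_integral.
Qed.

(* [A] is the likelihood-ratio test with threshold [k]: integrating
   [(1_A - f) (q - k p) >= 0] shows that it is at least as powerful as [f]. *)
Lemma neyman_pearson {R : realType} (P Q : probability (measurableTypeR R) R) (p q : R -> R)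
    (k : R) (A : set R) (f : R -> \bar R) :
  has_density P p -> has_density Q q -> 0 <= k -> measurable A ->
  (forall x, A x -> k * p x <= q x) -> (forall x, ~ A x -> q x <= k * p x) ->
  measurable_fun setT f -> (forall x, 0 <= f x <= 1)%E ->
  (\int[P]_x f x <= P A)%E -> (\int[Q]_x f x <= Q A)%E.
Proof.
move=> Pp Qq k0 mA Akpq NAkpq mf f01.
have f0 x : (0 <= f x)%E by case/andP: (f01 x).
have [mp p0 _] := Pp; have [mq q0 _] := Qq.
have m1 : measurable_fun setT (EFin \o \1_A : R -> \bar R).
  exact/measurable_EFinP/measurable_indic.
have i0 x : (0 <= (\1_A x)%:E :> \bar R)%E by rewrite lee_fin.
have PA (S : probability (measurableTypeR R) R) : S A = (\int[S]_x (\1_A x)%:E)%E.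
  by rewrite integral_indic// setIT.
have mM (g : R -> \bar R) (s : R -> R) : measurable_fun setT g -> measurable_fun setT s ->
    measurable_fun setT (fun x => g x * (s x)%:E)%E.
  by move=> mg ms; apply: emeasurable_funM => //; exact/measurable_EFinP.
rewrite !PA.
rewrite !(integral_density Pp, integral_density Qq)//.
move=> fA.
pose I := (\int[lebesgue_measure]_x ((\1_A x)%:E * (p x)%:E))%E.
have Ifin : I \is a fin_num.
  by rewrite /I -(integral_density Pp)// -PA fin_num_measure.
(* Subtraction-free form of the integrated inequality; finiteness of [I] lets [k%:E * I] be
   cancelled against the size bound [fA]. *)
suff H : (\int[lebesgue_measure]_x (f x * (q x)%:E) + k%:E * I <=
      \int[lebesgue_measure]_x ((\1_A x)%:E * (q x)%:E) +
      k%:E * \int[lebesgue_measure]_x (f x * (p x)%:E))%E.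
  rewrite -(leeD2rE (x := (k%:E * I)%E)) ?fin_numM//.
  apply: (le_trans H); rewrite leeD2l//.
  by apply: lee_wpmul2l => //; rewrite lee_fin.
rewrite -!ge0_integralZl//; last 4 first.
- exact: mM.
- by move=> x _; rewrite mule_ge0// lee_fin.
- exact: mM.
- by move=> x _; rewrite mule_ge0// lee_fin.
rewrite -!ge0_integralD//; last 8 first.
- by move=> x _; rewrite mule_ge0// lee_fin.
- exact: mM.
- by move=> x _; rewrite !mule_ge0// lee_fin.
- by apply: measurable_funeM; exact: mM.
- by move=> x _; rewrite mule_ge0// lee_fin.
- exact: mM.
- by move=> x _; rewrite !mule_ge0// lee_fin.
- by apply: measurable_funeM; exact: mM.
apply: ge0_le_integral => //.
- by move=> x _; rewrite adde_ge0// !mule_ge0// lee_fin.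
- by apply: emeasurable_funD; [exact: mM|apply: measurable_funeM; exact: mM].
- by apply: emeasurable_funD; [exact: mM|apply: measurable_funeM; exact: mM].
move=> x _; have := f01 x; case: (f x) => [r| |]; rewrite ?leye_eq ?andbF//.
rewrite !lee_fin => /andP[r0 r1] /=; rewrite indicE.
have [Ax|Ax] := pselect (A x).
  rewrite (mem_set Ax) /= => {fA}.
  have := mulr_ge0 (_ : 0 <= q x - k * p x) (_ : 0 <= 1 - r).
  by rewrite !subr_ge0 => /(_ (Akpq x Ax) r1) h; rewrite -subr_ge0; lra.
rewrite (memNset Ax) /= => {fA}.
have := mulr_ge0 (_ : 0 <= k * p x - q x) r0.
by rewrite !subr_ge0 => /(_ (NAkpq x Ax)) h; rewrite -subr_ge0; lra.
Qed.

(** Both sides become Lebesgue integrals, which the invariance of Lebesgue measure under [phi]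
    identifies, since [p] is [q] composed with [phi]. *)
Lemma integral_density_comp {R : realType} (P Q : probability (measurableTypeR R) R)
    (p q phi : R -> R) (f : R -> \bar R) :
  has_density P p -> has_density Q q -> lebesgue_preserving phi ->
  (forall x, q (phi x) = p x) -> measurable_fun setT f -> (forall x, 0 <= f x)%E ->
  (\int[P]_x f (phi x) = \int[Q]_x f x)%E.
Proof.
move=> Pp Qq phiP qp mf f0; have [mq q0 _] := Qq; have [mphi _] := phiP.
rewrite (integral_density Pp)//; last exact: measurableT_comp.
rewrite (integral_density Qq)// -[RHS](ge0_integral_preserving phiP).
- by under eq_integral do rewrite -qp.
- by apply: emeasurable_funM => //; exact/measurable_EFinP.
- by move=> x; rewrite mule_ge0// lee_fin.
Qed.

Lemma density_preimage {R : realType} (P Q : probability (measurableTypeR R) R)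
    (p q phi : R -> R) (A : set R) :
  has_density P p -> has_density Q q -> lebesgue_preserving phi ->
  (forall x, q (phi x) = p x) -> measurable A -> Q A = P (phi @^-1` A).
Proof.
move=> Pp Qq phiP qp mA; have [mphi _] := phiP.
have mB : measurable (phi @^-1` A) by rewrite -[X in measurable X]setTI; exact: mphi.
rewrite -[in LHS](setIT A) -integral_indic//.
rewrite -(integral_density_comp Pp Qq phiP qp)//; last exact/measurable_EFinP/measurable_indic.
by rewrite -[in RHS](setIT (phi @^-1` A)) -integral_indic.
Qed.

(** * Densities of the normal and Laplace laws; the function [Phi] *)

Lemma normal_has_density {R : realType} (m s : R) :
  has_density (normal_prob m s) (normal_pdf m s).
Proof.
split => [|x|//]; first exact: measurable_normal_pdf.
exact: normal_pdf_ge0.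
Qed.

Lemma laplace_has_density {R : realType} (m : R) (b : {posnum R}) :
  has_density (laplace_prob m b) (laplace_pdf m b).
Proof.
split => [|x|//]; first exact: measurable_laplace_pdf.
exact: laplace_pdf_ge0.
Qed.

Lemma density_set1 {R : realType} (P : probability (measurableTypeR R) R) (p : R -> R) (a : R) :
  has_density P p -> P [set a] = 0%E.
Proof. by move=> [_ _ PE]; rewrite PE// integral_set1. Qed.

(** A law with a density does not charge the endpoint [a], so both half-lines may be closed. *)
Lemma density_itv_compl {R : realType} (P : probability (measurableTypeR R) R)
    (p : R -> R) (a : R) :
  has_density P p -> P `[a, +oo[%classic = (1 - P `]-oo, a]%classic)%E.
Proof.
move=> Pp.
rewrite -probability_setC//.
rewrite setCitvl -(@setU1itv _ _ +oo%O a false) ?bnd_simp//.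
rewrite measureU//; first by rewrite [X in (X + _)%E](density_set1 a Pp) add0e.
by apply/seteqP; split => x //= -[->]; rewrite in_itv/= ltxx.
Qed.

Lemma normal_pdf1E {R : realType} (m x : R) :
  normal_pdf m 1 x = normal_peak 1 * expR (- ((x - m) ^+ 2 / 2)).
Proof. by rewrite normal_pdfE ?oner_eq0// /normal_fun expr1n mulNr. Qed.

(** The likelihood ratio of two unit-variance normal laws is monotone in [x]; this makes half-lines
    optimal tests and yields the log-concavity of [Phi]. *)
Lemma normal_pdf_tilt {R : realType} (m x : R) :
  normal_pdf m 1 x = expR (x * m - m ^+ 2 / 2) * normal_pdf 0 1 x.
Proof.
rewrite !normal_pdf1E mulrCA; congr (_ * _); rewrite -expRD; congr expR.
by field.
Qed.

Lemma PhiE {R : realType} (x : R) : (Phi x)%:E = normal_prob 0 1 `]-oo, x]%classic.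
Proof. by rewrite /Phi fineK// fin_num_measure. Qed.

Lemma normal_pdf_shift {R : realType} (m x : R) :
  normal_pdf m 1 (m + x) = normal_pdf 0 1 x.
Proof. by rewrite !normal_pdf1E (_ : m + x - m = x - 0)//; ring. Qed.

Lemma normal_prob_Nyc {R : realType} (m x : R) :
  normal_prob m 1 `]-oo, x]%classic = (Phi (x - m))%:E.
Proof.
rewrite PhiE (density_preimage (normal_has_density 0 1) (normal_has_density m 1)
  (lebesgue_preserving_shift m) (normal_pdf_shift m))//.
by congr (normal_prob _ _ _); apply/seteqP; split => y /=; rewrite !in_itv/= lerBrDl.
Qed.

Lemma normal_prob_cy {R : realType} (m x : R) :
  normal_prob m 1 `[x, +oo[%classic = (Phi (m - x))%:E.
Proof.
rewrite (_ : m - x = - x - - m); last by ring.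
rewrite -normal_prob_Nyc.
rewrite (density_preimage (normal_has_density (- m) 1) (normal_has_density m 1)
  lebesgue_preserving_opp)//.
  by congr (normal_prob _ _ _); apply/seteqP; split => y /=; rewrite !in_itv/= andbT lerNr.
by move=> y; rewrite !normal_pdf1E (_ : - y - m = - (y - - m)) ?sqrrN//; ring.
Qed.

Lemma PhiN {R : realType} (x : R) : Phi (- x) = 1 - Phi x.
Proof.
apply: EFin_inj; rewrite EFinB (PhiE x) -(density_itv_compl _ (normal_has_density 0 1)).
by rewrite [RHS](normal_prob_cy 0 x) sub0r.
Qed.

Lemma PhiB {R : realType} (x y : R) : x <= y ->
  (Phi y - Phi x)%:E = normal_prob 0 1 `]x, y]%classic.
Proof.
move=> xy; rewrite EFinB !PhiE.
have -> : `]-oo, y]%classic = `]-oo, x]%classic `|` `]x, y]%classic :> set R.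
  by rewrite -itv_bndbnd_setU.
rewrite measureU//=; last first.
  by apply/seteqP; split => z //= -[]; rewrite !in_itv/= => zx /andP[]; rewrite ltNge zx.
by rewrite addeAC subee ?add0e// fin_num_measure.
Qed.

Lemma Phi_lipschitz {R : realType} (x y : R) : x <= y ->
  Phi y - Phi x <= normal_peak 1 * (y - x).
Proof.
move=> xy; rewrite -lee_fin PhiB// /normal_prob.
apply: (@le_trans _ _ (\int[lebesgue_measure]_(z in `]x, y]) (normal_peak 1)%:E)%E).
  apply: ge0_le_integral => //.
  - by move=> z _; rewrite lee_fin normal_pdf_ge0.
  - by apply/measurable_EFinP/measurable_funTS; exact: measurable_normal_pdf.
  - by move=> z _; rewrite lee_fin normal_pdf_ub// oner_eq0.
rewrite integral_cst//= lebesgue_measure_itv/= lte_fin.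
case: ifP => [_|]; first by rewrite -EFinB -EFinM.
by move=> _; rewrite mule0 lee_fin mulr_ge0 ?normal_peak_ge0// subr_ge0.
Qed.

Lemma Phi_lt {R : realType} : {mono @Phi R : x y / x < y}.
Proof.
apply: leW_mono; apply: le_mono => x y xy.
rewrite -subr_gt0 -lte_fin PhiB ?(ltW xy)// /normal_prob.
(* [c] bounds the density from below on the interval, because [z ^+ 2] is at most [x ^+ 2 + y ^+ 2]
   whichever sign [z] has. *)
pose c : R := normal_peak 1 * expR (- ((x ^+ 2 + y ^+ 2) / 2)).
have c0 : 0 < c by rewrite mulr_gt0 ?expR_gt0// normal_peak_gt0// oner_eq0.
apply: (@lt_le_trans _ _ (\int[lebesgue_measure]_(z in `]x, y]) c%:E)%E).
  rewrite integral_cst//= lebesgue_measure_itv/= lte_fin xy -EFinB -EFinM.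
  by rewrite lte_fin mulr_gt0// subr_gt0.
apply: ge0_le_integral => //.
- by move=> z _; rewrite lee_fin ltW.
- by apply/measurable_EFinP/measurable_funTS; exact: measurable_normal_pdf.
- move=> z /=; rewrite in_itv/= => /andP[xz zy].
  rewrite lee_fin normal_pdf1E subr0 ler_wpM2l ?normal_peak_ge0// ler_expR lerN2.
  rewrite ler_pM2r ?invr_gt0//; have [z0|z0] := leP 0 z.
    by rewrite ler_wpDl ?sqr_ge0// ler_sqr// nnegrE (le_trans z0).
  rewrite ler_wpDr ?sqr_ge0// -sqrrN -[leRHS]sqrrN ler_sqr ?nnegrE ?oppr_ge0 ?lerN2 ?ltW//.
  exact: lt_trans z0.
Qed.

Lemma Phi_le {R : realType} : {mono @Phi R : x y / x <= y}.
Proof. by apply: le_mono => x y; rewrite Phi_lt. Qed.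

Lemma Phi_gt0 {R : realType} (x : R) : 0 < Phi x.
Proof.
apply: (@le_lt_trans _ _ (Phi (x - 1))); first by rewrite -lee_fin PhiE.
by rewrite Phi_lt ltrBlDr ltrDl.
Qed.

Lemma continuous_Phi {R : realType} : continuous (@Phi R).
Proof.
move=> x; apply/cvgrPdist_le => /= e e0.
have c0 : 0 < normal_peak 1 :> R by rewrite normal_peak_gt0// oner_eq0.
near=> y.
have H : `|Phi x - Phi y| <= normal_peak 1 * `|x - y|.
  have [xy|/ltW yx] := leP x y.
    by rewrite !ler0_norm ?subr_le0 ?Phi_le// !opprB Phi_lipschitz.
  by rewrite !ger0_norm ?subr_ge0 ?Phi_le// Phi_lipschitz.
apply: (le_trans H); rewrite mulrC -ler_pdivlMr//.
near: y; apply: (@cvgr_dist_le _ R^o); first exact: cvg_id.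
by rewrite divr_gt0.
Unshelve. all: by end_near. Qed.

Lemma Phi_small {R : realType} (e : R) : 0 < e -> exists x, Phi x < e.
Proof.
move=> e0.
(* The identity is a random variable with distribution function [Phi], which therefore tends to 0 at
   minus infinity. *)
pose idR : measurableTypeR R -> R := idfun.
pose X_mixin := @isMeasurableFun.Build _ _ _ _ idR (@measurable_id _ _ setT).
pose X : {RV (normal_prob 0 1) >-> R} := HB.pack idR X_mixin.
have := cvg_cdfNy0 X.
move=> /fine_cvgP[_ /cvgrPdist_lt/(_ e e0)].
move=> -[M [Mreal H]].
exists (M - 1).
have /H /= : M - 1 < M by rewrite ltrBlDr ltrDl.
rewrite sub0r normrN; apply: le_lt_trans.
exact: ler_norm.
Qed.

Lemma Phi_surj {R : realType} (a : R) : 0 < a < 1 -> exists x, Phi x = a.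
Proof.
move=> /andP[a0 a1]; have [x xa] := Phi_small a0.
have [y ya] : exists y : R, Phi y < 1 - a by apply: Phi_small; rewrite subr_gt0.
have {}ya : a < Phi (- y) by rewrite PhiN; lra.
have xy : x <= - y by rewrite -Phi_le; exact/ltW/(lt_trans xa).
have [||c _ <-] := @IVT R Phi x (- y) a xy; last by exists c.
  exact/continuous_subspaceT/continuous_Phi.
by rewrite min_l ?max_r ?Phi_le// !ltW.
Qed.

(* On [v >= y - h] the density ratio [n (v + h) / n v] is at most its value C at
   [v = y - h], and at least C below; integrate on both sides of [y - h]. *)
Lemma Phi_ratio {R : realType} (y z h : R) : 0 <= h -> y <= z ->
  Phi (y - h) * Phi z <= Phi (z - h) * Phi y.
Proof.
move=> h0 yz.
(* The factor of [normal_pdf_tilt] for the mean [- h], taken at [y - h]; it is nonincreasing in its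
   argument. *)
pose C := expR ((y - h) * - h - (- h) ^+ 2 / 2).
have C0 : 0 < C by exact: expR_gt0.
have mn m (A : set R) : measurable_fun A (fun x => (normal_pdf m 1 x)%:E).
  by apply/measurable_EFinP/measurable_funTS; exact: measurable_normal_pdf.
have n0 m (x : R) : (0 <= (normal_pdf m 1 x)%:E)%E by rewrite lee_fin normal_pdf_ge0.
have lo : C * Phi (y - h) <= Phi y.
  have Ey : (Phi y)%:E = normal_prob (- h) 1 `]-oo, y - h]%classic.
    by rewrite normal_prob_Nyc opprK subrK.
  rewrite -lee_fin EFinM Ey PhiE.
  rewrite /normal_prob -ge0_integralZl//; [|exact: mn|by rewrite lee_fin ltW].
  apply: ge0_le_integral => //; [|apply: measurable_funeM; exact: mn|exact: mn|].
    by move=> v _; rewrite mule_ge0// lee_fin ltW.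
  move=> v /=; rewrite in_itv/= => vy; rewrite -EFinM lee_fin [leRHS]normal_pdf_tilt.
  by rewrite ler_wpM2r ?normal_pdf_ge0// ler_expR lerD2r ler_wnM2r// oppr_le0.
have hi : Phi z - Phi y <= C * (Phi (z - h) - Phi (y - h)).
  have Ez : (Phi z - Phi y)%:E = normal_prob (- h) 1 `]y - h, z - h]%classic.
    rewrite (PhiB yz).
    rewrite [RHS](density_preimage (normal_has_density 0 1) (normal_has_density (- h) 1)
      (lebesgue_preserving_shift (- h)) (normal_pdf_shift (- h)) (measurable_itv _)).
    congr (normal_prob _ _ _); apply/seteqP; split => v /=; rewrite !in_itv/=;
      by move=> /andP[? ?]; apply/andP; split; lra.
  rewrite -lee_fin EFinM Ez PhiB ?lerD2r//.
  rewrite /normal_prob -ge0_integralZl//; [|exact: mn|by rewrite lee_fin ltW].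
  apply: ge0_le_integral => //; [exact: mn|apply: measurable_funeM; exact: mn|].
  move=> v /=; rewrite in_itv/= => /andP[vy _]; rewrite -EFinM lee_fin normal_pdf_tilt.
  by rewrite ler_wpM2r ?normal_pdf_ge0// ler_expR lerD2r ler_wnM2r ?oppr_le0// ltW.
(* Multiply [hi] by [Phi (y - h)] and [lo] by the increment of [Phi] over []y - h, z - h]]; when
   they are chained, the products [Phi y * Phi (y - h)] cancel. *)
have hi' := ler_wpM2l (ltW (Phi_gt0 (y - h))) hi.
have d0 : 0 <= Phi (z - h) - Phi (y - h) by rewrite subr_ge0 Phi_le lerD2r.
have lo' := ler_wpM2r d0 lo.
rewrite -subr_ge0; set p1 := Phi (y - h) in hi' lo' *; set p2 := Phi (z - h) in hi' lo' *.
nra.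
Qed.

(** For a fixed sum of the arguments, bringing them closer does not decrease the product; this is
    [Phi_ratio] with the shift [d - b]. *)
Lemma Phi_log_concave {R : realType} (a b c d : R) :
  a + d = b + c -> a <= b -> b <= d -> Phi a * Phi d <= Phi b * Phi c.
Proof.
move=> adbc ab bd; have ad : a = c - (d - b) by lra.
have := @Phi_ratio R c d (d - b); rewrite subKr -ad; apply; lra.
Qed.

(** * One-dimensional Laplace laws and their tests *)

(* The distribution function of [Lap(0, 1)]. *)
Definition lcdf {R : realType} (x : R) : R :=
  if x <= 0 then expR x / 2 else 1 - expR (- x) / 2.

Lemma lcdf_le0 {R : realType} (x : R) : x <= 0 -> lcdf x = expR x / 2.
Proof. by rewrite /lcdf => ->. Qed.

Lemma lcdf_ge0 {R : realType} (x : R) : 0 <= x -> lcdf x = 1 - expR (- x) / 2.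
Proof.
rewrite /lcdf le_eqVlt => /predU1P[<-|]; first by rewrite lexx oppr0 expR0; lra.
by rewrite leNgt => ->.
Qed.

Lemma lcdfN {R : realType} (x : R) : lcdf (- x) = 1 - lcdf x.
Proof.
have [x0|x0] := leP x 0.
  by rewrite (lcdf_le0 x0) lcdf_ge0 ?oppr_ge0// opprK.
by rewrite lcdf_le0 ?oppr_le0 ?(ltW x0)// lcdf_ge0 ?(ltW x0)//; lra.
Qed.

Lemma lcdf_surj {R : realType} (a : R) : 0 < a < 1 -> exists x, lcdf x = a.
Proof.
(* By [lcdfN] it suffices to invert the exponential branch. *)
wlog a2 : a / a <= 2^-1.
  move=> H a01; have [a2|a2] := leP a 2^-1; first exact: H.
  have [||x xa] := H (1 - a); [lra|lra|].
  by exists (- x); rewrite lcdfN xa; lra.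
move=> /andP[a0 a1]; exists (ln (2 * a)).
have a20 : 0 < 2 * a by lra.
rewrite lcdf_le0; first by rewrite lnK ?posrE//; lra.
by rewrite ln_le0//; lra.
Qed.

Lemma lcdf_homo {R : realType} : {homo @lcdf R : x y / x <= y}.
Proof.
move=> x y xy.
have [y0|/ltW y0] := leP y 0.
  by rewrite !lcdf_le0 ?(le_trans xy)// ler_pM2r ?invr_gt0// ler_expR.
rewrite (lcdf_ge0 y0); have [x0|/ltW x0] := leP x 0.
  rewrite (lcdf_le0 x0).
  have ex : expR x <= 1 by rewrite -expR0 ler_expR.
  have ey : expR (- y) <= 1 by rewrite -expR0 ler_expR oppr_le0.
  lra.
by rewrite (lcdf_ge0 x0) lerD2l lerN2 ler_pM2r ?invr_gt0// ler_expR lerN2.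
Qed.

Lemma lcdf_nonneg {R : realType} (x : R) : 0 <= lcdf x.
Proof.
have [x0|/ltW x0] := leP x 0; first by rewrite lcdf_le0// divr_ge0// expR_ge0.
have : expR (- x) <= 1 by rewrite -expR0 ler_expR oppr_le0.
by rewrite lcdf_ge0//; lra.
Qed.

Lemma laplace_prob_tail {R : realType} (m : R) (b : {posnum R}) (y : R) : m <= y ->
  laplace_prob m b `[y, +oo[%classic = (expR (- ((y - m) / b%:num)) / 2)%:E.
Proof.
move=> my; rewrite /laplace_prob.
(* To the right of [m] the absolute value opens, and [F] is an antiderivative of the density with
   limit 0 at plus infinity. *)
pose F x : R := - (expR (- ((x - m) / b%:num)) / 2).
have dF (x : R) : is_derive (x : R^o) (1 : R^o) (F : R^o -> R^o)
    ((2 * b%:num)^-1 * expR (- ((x - m) / b%:num))).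
  apply: is_derive_eq; rewrite !scaler0 !(subr0, addr0, add0r, oppr0) /=.
  by rewrite /GRing.scale/=; field.
have cF : continuous F by move=> x; apply/differentiable_continuous/derivable1_diffP.
rewrite (@ge0_continuous_FTC2y _ _ F _ 0)//.
- by rewrite /F -EFinB sub0r opprK.
- by move=> x _; exact: laplace_pdf_ge0.
- exact/continuous_subspaceT/continuous_laplace_pdf.
- rewrite -oppr0 -(mul0r 2^-1); apply: cvgN; apply: cvgMr_tmp.
  apply: (@cvg_comp _ _ _ (fun x => (x - m) / b%:num) (fun z => expR (- z)) _ (pinfty_nbhs R));
    last exact: cvgr_expR.
  by apply: gt0_cvgMly; [rewrite invr_gt0|exact: cvg_addrr].
- by apply: cvg_at_right_filter; exact: cF.
- move=> x; rewrite in_itv/= andbT => yx; rewrite derive1E derive_val /laplace_pdf.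
  by rewrite ger0_norm// subr_ge0 (le_trans my)// ltW.
Qed.

Lemma laplace_pdfN {R : realType} (m : R) (b : {posnum R}) (x : R) :
  laplace_pdf (- m) b (- x) = laplace_pdf m b x.
Proof. by rewrite /laplace_pdf -opprD normrN. Qed.

Lemma laplace_prob_cy {R : realType} (m : R) (b : {posnum R}) (y : R) :
  laplace_prob m b `[y, +oo[%classic = (lcdf ((m - y) / b%:num))%:E.
Proof.
have [my|ym] := leP m y.
  rewrite laplace_prob_tail// lcdf_le0; last by rewrite pmulr_lle0 ?invr_gt0// subr_le0.
  by rewrite -mulNr opprB.
(* Below the centre, passing to the complement and reflecting leaves a tail of the law centred at
   [- m]. *)
rewrite (density_itv_compl _ (laplace_has_density m b)).
rewrite (density_preimage (laplace_has_density (- m) b) (laplace_has_density m b)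
  lebesgue_preserving_opp)//;
  last by move=> x; rewrite -laplace_pdfN opprK.
rewrite lcdf_ge0 ?divr_ge0 ?subr_ge0 ?(ltW ym)// EFinB; congr (_ - _)%E.
have -> : -%R @^-1` `]-oo, y]%classic = `[- y, +oo[%classic.
  by apply/seteqP; split => x /=; rewrite !in_itv/= andbT lerNl.
rewrite [LHS](laplace_prob_tail b (_ : - m <= - y)) ?lerN2 ?(ltW ym)//.
by rewrite (_ : - y - - m = m - y)//; ring.
Qed.

Lemma laplace_prob_Nyc {R : realType} (m : R) (b : {posnum R}) (y : R) :
  laplace_prob m b `]-oo, y]%classic = (lcdf ((y - m) / b%:num))%:E.
Proof.
rewrite (density_preimage (laplace_has_density (- m) b) (laplace_has_density m b)
  lebesgue_preserving_opp)//;
  last by move=> x; rewrite -laplace_pdfN opprK.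
have -> : -%R @^-1` `]-oo, y]%classic = `[- y, +oo[%classic.
  by apply/seteqP; split => x /=; rewrite !in_itv/= andbT lerNl.
by rewrite [LHS]laplace_prob_cy (_ : - m - - y = y - m)//; ring.
Qed.

(** The distance from [t] to [m] minus that to [m'] is nondecreasing in [t]. So the Laplace
    likelihood ratio is monotone, and half-lines are likelihood-ratio tests although the ratio is
    constant outside [[m, m']]. *)
Lemma dist_rearrange {R : realType} (m m' s y : R) : m <= m' -> s <= y ->
  `|y - m'| + `|s - m| <= `|y - m| + `|s - m'|.
Proof.
by move=> *; case: (lerP y m'); case: (lerP s m); case: (lerP y m); case: (lerP s m'); lra.
Qed.

(** Neyman-Pearson against the half-line pointing from [m] towards [m'], whose endpoint [s] is
    chosen so that its mass at location [m] is [lcdf x]; the threshold [k] is the likelihood ratio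
    at [s]. *)
Lemma laplace_test_shift {R : realType} (m m' x : R) (b : {posnum R}) (f : R -> \bar R) :
  measurable_fun setT f -> (forall x, 0 <= f x <= 1)%E ->
  (\int[laplace_prob m b]_x f x <= (lcdf x)%:E)%E ->
  (\int[laplace_prob m' b]_x f x <= (lcdf (x + `|m - m'| / b%:num))%:E)%E.
Proof.
move=> mf f01 fx.
have b0 : b%:num != 0 by [].
have ratio s y : `|y - m'| + `|s - m| <= `|y - m| + `|s - m'| ->
    expR ((`|s - m| - `|s - m'|) / b%:num) * laplace_pdf m b y <= laplace_pdf m' b y.
  move=> H; rewrite /laplace_pdf mulrCA ler_pM2l ?invr_gt0//.
  rewrite -expRD ler_expR -subr_ge0.
  rewrite (_ : _ - _ = (`|y - m| + `|s - m'| - (`|y - m'| + `|s - m|)) / b%:num).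
    by rewrite divr_ge0// subr_ge0.
  by field.
have ratio' s y : `|y - m| + `|s - m'| <= `|y - m'| + `|s - m| ->
    laplace_pdf m' b y <= expR ((`|s - m| - `|s - m'|) / b%:num) * laplace_pdf m b y.
  move=> H; rewrite /laplace_pdf mulrCA ler_pM2l ?invr_gt0//.
  rewrite -expRD ler_expR -subr_ge0.
  rewrite (_ : _ - _ = (`|y - m'| + `|s - m| - (`|y - m| + `|s - m'|)) / b%:num).
    by rewrite divr_ge0// subr_ge0.
  by field.
have [mm|/ltW mm] := leP m m'.
  pose s := m - b%:num * x.
  have Es : (m - s) / b%:num = x by rewrite /s; field.
  have Es' : (m' - s) / b%:num = x + (m' - m) / b%:num by rewrite /s; field.
  rewrite ler0_norm ?subr_le0// opprB -Es' -laplace_prob_cy.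
  apply: (neyman_pearson (laplace_has_density m b) (laplace_has_density m' b)
    (k := expR ((`|s - m| - `|s - m'|) / b%:num))) => //.
  - move=> y /=; rewrite in_itv/= andbT => sy; apply: ratio.
    exact: dist_rearrange.
  - move=> y /=; rewrite in_itv/= andbT => /negP; rewrite -ltNge => ys; apply: ratio'.
    by rewrite addrC [leRHS]addrC dist_rearrange// ltW.
  - by rewrite [leRHS]laplace_prob_cy Es.
pose s := m + b%:num * x.
have Es : (s - m) / b%:num = x by rewrite /s; field.
have Es' : (s - m') / b%:num = x + (m - m') / b%:num by rewrite /s; field.
rewrite ger0_norm ?subr_ge0// -Es' -laplace_prob_Nyc.
apply: (neyman_pearson (laplace_has_density m b) (laplace_has_density m' b)
  (k := expR ((`|s - m| - `|s - m'|) / b%:num))) => //.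
- move=> y /=; rewrite in_itv/= => sy; apply: ratio.
  by rewrite addrC [leRHS]addrC dist_rearrange.
- move=> y /=; rewrite in_itv/= => /negP; rewrite -ltNge => ys; apply: ratio'.
  by rewrite dist_rearrange// ltW.
- by rewrite [leRHS]laplace_prob_Nyc Es.
Qed.

(** * Tests between translated Laplace vectors *)

Lemma measurable_add_tuple {R : realType} p (u : p.-tuple R) :
  measurable_fun setT (add_tuple u).
Proof. exact: measurable_funPT. Qed.

Lemma add_tuple_cons {R : realType} p (u0 a : R) (u : p.-tuple R)
    (w : p.-tuple (measurableTypeR R)) :
  add_tuple [tuple of u0 :: u] (cons_pair (a : measurableTypeR R, w)) =
  cons_pair ((u0 + a : R) : measurableTypeR R, add_tuple u w).
Proof.
apply: eq_from_tnth => i; rewrite tnth_mktuple.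
by have [j ->|->] := unliftP ord0 i; rewrite ?tnth0 ?tnthS ?tnth_mktuple.
Qed.

Lemma l1dist_cons {R : realType} p (u0 v0 : R) (u v : p.-tuple R) :
  l1dist [tuple of u0 :: u] [tuple of v0 :: v] = `|u0 - v0| + l1dist u v.
Proof.
rewrite /l1dist big_ord_recl !tnth0; congr (_ + _).
by apply: eq_bigr => i _; rewrite !tnthS.
Qed.

Lemma integral01 d (T : measurableType d) (R : realType) (P : probability T R)
    (f : T -> \bar R) :
  measurable_fun setT f -> (forall x, 0 <= f x <= 1)%E -> (0 <= \int[P]_x f x <= 1)%E.
Proof.
move=> mf f01; apply/andP; split.
  by apply: integral_ge0 => x _; case/andP: (f01 x).
rewrite -(probability_setT P) -[leRHS]mul1e -integral_cst//.
apply: ge0_le_integral => //; first by move=> x _; case/andP: (f01 x).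
by move=> x _; case/andP: (f01 x).
Qed.

(* Moves the coordinates one at a time: by Fubini, integrating out the other
   coordinates turns [f] into a one-dimensional test. *)
Lemma laplace_vector_test_shift {R : realType} (b : {posnum R}) p (u u' : p.-tuple R)
    (f : p.-tuple (measurableTypeR R) -> \bar R) (x : R) :
  measurable_fun setT f -> (forall v, 0 <= f v <= 1)%E ->
  (\int[product_law (fun _ : 'I_p => laplace_prob 0 b)]_v f (add_tuple u v) <=
     (lcdf x)%:E)%E ->
  (\int[product_law (fun _ : 'I_p => laplace_prob 0 b)]_v f (add_tuple u' v) <=
     (lcdf (x + l1dist u u' / b%:num))%:E)%E.
Proof.
elim: p u u' f x => [|p IH] u u' f x mf f01.
  by rewrite (tuple0 u) (tuple0 u') /l1dist big_ord0 mul0r addr0.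
case/tupleP: u => u0 u; case/tupleP: u' => u0' u'.
rewrite l1dist_cons mulrDl addrA.
pose L := product_law (fun _ : 'I_p => laplace_prob (0 : R) b).
pose L0 : probability (measurableTypeR R) R := laplace_prob 0 b.
have f0 v : (0 <= f v)%E by case/andP: (f01 v).
pose g (z : measurableTypeR R * p.-tuple (measurableTypeR R)) : \bar R := f (cons_pair z).
have mg : measurable_fun setT g.
  by apply: measurableT_comp => //; exact: measurable_funPT.
have mga c (t : p.-tuple R) : measurable_fun setT
    (fun z : measurableTypeR R * p.-tuple (measurableTypeR R) =>
      g ((c + z.1 : R) : measurableTypeR R, add_tuple t z.2)).
  apply: measurableT_comp => //; apply/measurable_fun_pairP; split.
    by apply: measurable_funD => //; exact: measurable_fst.
  exact: (measurableT_comp (measurable_add_tuple t) measurable_snd).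
have E c (t : p.-tuple R) :
    (\int[product_law (fun _ : 'I_p.+1 => laplace_prob 0 b)]_v f (add_tuple [tuple of c :: t] v) =
     \int[L0]_a \int[L]_w g ((c + a)%R : measurableTypeR R, add_tuple t w))%E.
  rewrite [LHS]ge0_integral_pushforward//; last first.
    exact: (measurableT_comp mf (measurable_add_tuple _)).
  rewrite preimage_setT.
  rewrite -[RHS](fubini_tonelli1 _ (mga c t))//; last by move=> z; exact: f0.
  by apply: eq_integral => -[a w] _ /=; rewrite add_tuple_cons.
have mgw c : measurable_fun setT (fun w => g (c, w)).
  exact: (measurableT_comp mg (measurable_pair1 c)).
have mgt (t : p.-tuple R) : measurable_fun setT
    (fun z : measurableTypeR R * p.-tuple (measurableTypeR R) => g (z.1, add_tuple t z.2)).
  apply: measurableT_comp => //; apply/measurable_fun_pairP; split.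
    exact: measurable_fst.
  exact: (measurableT_comp (measurable_add_tuple t) measurable_snd).
(* [f1] averages over the tail, still located at [u]: a one-dimensional test, used to move the first
   location from [u0] to [u0']. *)
pose f1 (a : measurableTypeR R) : \bar R := (\int[L]_w g (a, add_tuple u w))%E.
have mf1 : measurable_fun setT f1.
  exact: (measurable_fun_fubini_tonelli_F _ (mgt u) (fun z => f0 _)).
have f101 a : (0 <= f1 a <= 1)%E.
  apply: integral01 => [|w]; last exact: f01.
  exact: (measurableT_comp (mgw a) (measurable_add_tuple u)).
(* [f2] averages over the first coordinate, now located at [u0']: a test of the tail, to which the
   induction hypothesis applies. *)
pose f2 (w : p.-tuple (measurableTypeR R)) : \bar R :=
  (\int[L0]_a g ((u0' + a)%R : measurableTypeR R, w))%E.
have mg2 : measurable_fun setT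
    (fun z : measurableTypeR R * p.-tuple (measurableTypeR R) =>
      g ((u0' + z.1)%R : measurableTypeR R, z.2)).
  apply: measurableT_comp => //; apply/measurable_fun_pairP; split.
    by apply: measurable_funD => //; exact: measurable_fst.
  exact: measurable_snd.
have mf2 : measurable_fun setT f2.
  exact: (measurable_fun_fubini_tonelli_G _ mg2 (fun z => f0 _)).
have f201 w : (0 <= f2 w <= 1)%E.
  apply: integral01 => [|a]; last exact: f01.
  apply: measurableT_comp => //; apply/measurable_fun_pairP.
  by split; [exact: measurable_funD|exact: measurable_cst].
(* Translating the argument of the test amounts to moving the location of the law. *)
have shiftL c : (\int[L0]_a f1 (c + a)%R = \int[laplace_prob c b]_a f1 a)%E.
  apply: (integral_density_comp (laplace_has_density 0 b) (laplace_has_density c b)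
    (lebesgue_preserving_shift c)) => //.
    by move=> a; rewrite /laplace_pdf addrAC subrr add0r subr0.
  by move=> a; case/andP: (f101 a).
rewrite !E => H1.
have {}H1 : (\int[L0]_a f1 (u0 + a)%R <= (lcdf x)%:E)%E by exact: H1.
rewrite (shiftL u0) in H1.
have := laplace_test_shift u0' mf1 f101 H1.
rewrite -(shiftL u0') => H2.
have swap (t : p.-tuple R) :
    (\int[L0]_a \int[L]_w g ((u0' + a)%R : measurableTypeR R, add_tuple t w) =
     \int[L]_w f2 (add_tuple t w))%E.
  by apply: (fubini_tonelli _ (mga u0' t)) => z; exact: f0.
rewrite swap; apply: (IH u) => //.
rewrite -swap; exact: H2.
Qed.

Lemma M_Lap_test_shift {R : realType} (X : Type) n p (theta : n.-tuple X -> p.-tuple R)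
    (b : {posnum R}) (S S' : n.-tuple X)
    (f : p.-tuple (measurableTypeR R) -> \bar R) (x : R) :
  measurable_fun setT f -> (forall v, 0 <= f v <= 1)%E ->
  (\int[M_Lap theta b S]_v f v <= (lcdf x)%:E)%E ->
  (\int[M_Lap theta b S']_v f v <=
     (lcdf (x + l1dist (theta S) (theta S') / b%:num))%:E)%E.
Proof.
move=> mf f01.
have E s : (\int[M_Lap theta b s]_v f v =
    \int[product_law (fun _ : 'I_p => laplace_prob 0 b)]_v f (add_tuple (theta s) v))%E.
  have LE : Lap_p [tuple 0 | _ < p] b = product_law (fun _ : 'I_p => laplace_prob 0 b).
    rewrite /Lap_p; congr product_law; apply/funext => i.
    by rewrite tnth_mktuple.
  rewrite /M_Lap LE.
  have := ge0_integral_pushforward (measurable_add_tuple (theta s))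
    (product_law (fun _ : 'I_p => laplace_prob 0 b)) measurableT mf.
  by rewrite preimage_setT; apply => v _; case/andP: (f01 v).
by rewrite !E; exact: laplace_vector_test_shift.
Qed.

(** * Comparison of the Laplace and normal distribution functions *)

Lemma Phi0 {R : realType} : Phi (0 : R) = 2^-1.
Proof. by have := @PhiN R 0; rewrite oppr0; lra. Qed.

(* [Phi^-1 \o lcdf] is odd and, by log-concavity of [Phi], concave on the positive
   half-line, so its increment over an interval of length [d] is largest for
   the interval centred at 0. *)
Lemma lcdf_Phi_shift {R : realType} (mu d x s : R) : 0 <= d ->
  Phi (- (mu / 2)) <= lcdf (- (d / 2)) -> Phi s = lcdf x ->
  lcdf (x + d) <= Phi (s + mu).
Proof.
move=> d0; rewrite lcdf_le0; last by rewrite oppr_le0 divr_ge0.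
set c := Phi _ => cd sx.
(* The Laplace value at [- (d / 2)] is at most 1/2, which is [Phi 0]. *)
have mu0 : 0 <= mu.
  have : expR (- (d / 2)) <= 1 by rewrite -expR0 ler_expR oppr_le0 divr_ge0.
  move=> ?; have : c <= Phi 0 by rewrite Phi0; lra.
  by rewrite Phi_le; lra.
pose E := expR (- d).
have cc : c * c <= E / 4.
  have -> : E / 4 = (expR (- (d / 2)) / 2) * (expR (- (d / 2)) / 2).
    by rewrite /E mulrACA -expRD; congr (expR _ * _); field.
  by rewrite ler_pM// ltW// Phi_gt0.
(* [K1] serves two points on the same side of 0. With the sum of the arguments kept, [(- t - mu, 0)]
   moves inward to [(- t, - mu)], then [(- mu, 0)] to its midpoint, where [cc] applies. *)
have K1 t : 0 <= t -> Phi (- t - mu) <= E * Phi (- t).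
  move=> t0.
  have h1 : Phi (- t - mu) * Phi 0 <= Phi (- t) * Phi (- mu).
    by apply: Phi_log_concave; lra.
  have h2 : Phi (- mu) * Phi 0 <= c * c by apply: Phi_log_concave; lra.
  rewrite Phi0 in h1 h2.
  have h3 : Phi (- t) * Phi (- mu) <= Phi (- t) * (E / 2).
    by rewrite ler_pM2l ?Phi_gt0//; lra.
  lra.
(* [K2] serves points on opposite sides of 0: the arguments sum to [- mu], so the product is at most
   its value [c * c] at the midpoint. *)
have K2 t : Phi t * Phi (- t - mu) <= E / 4.
  apply: le_trans cc; have [tm|tm] := leP t (- (mu / 2)).
    by apply: Phi_log_concave; lra.
  by rewrite mulrC; apply: Phi_log_concave; lra.
have ->: Phi (s + mu) = 1 - Phi (- s - mu) by rewrite -PhiN; congr Phi; ring.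
(* In terms of upper tails, the claim is [K1] when [0 <= x] and [K2] when [x < 0 <= x + d]. *)
have [x0|x0] := leP 0 x.
  move: sx; rewrite (lcdf_ge0 x0) lcdf_ge0 ?addr_ge0// opprD expRD => sx.
  have s0 : 0 <= s.
    have : expR (- x) <= 1 by rewrite -expR0 ler_expR oppr_le0.
    by move=> ?; have : Phi 0 <= Phi s; [rewrite Phi0 sx; lra|rewrite Phi_le].
  have := K1 s s0; rewrite PhiN sx /E; lra.
have [xd|xd] := leP 0 (x + d).
  move: sx; rewrite (lcdf_le0 (ltW x0)) (lcdf_ge0 xd) opprD expRD -/E => sx.
  have := K2 s; rewrite sx => H.
  have := ler_wpM2l (expR_ge0 (- x)) H.
  rewrite [X in X <= _](_ : _ = (expR (- x) * expR x) * Phi (- s - mu) / 2); last by ring.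
  by rewrite -expRD addNr expR0; lra.
move: sx; rewrite (lcdf_le0 (ltW x0)) (lcdf_le0 (ltW xd)) => sx.
(* Both points lie left of 0. If [0 <= s + mu], then 1/2 separates the two values; otherwise [K1]
   applies after reflection, at [- (s + mu)]. *)
have [sm|sm] := leP 0 (s + mu).
  have : Phi 0 <= Phi (s + mu) by rewrite Phi_le.
  have : expR (x + d) <= 1 by rewrite -expR0 ler_expR ltW.
  by rewrite Phi0 (_ : - s - mu = - (s + mu)) ?PhiN; [lra|ring].
have := K1 (- (s + mu)); rewrite opprK (_ : s + mu - mu = s); last by ring.
rewrite sx oppr_ge0 => /(_ (ltW sm)) H.
have := ler_wpM2l (expR_ge0 d) H; rewrite [X in _ <= X]mulrA -expRD subrr expR0 mul1r.
rewrite expRD (_ : - s - mu = - (s + mu)); last by ring.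
rewrite PhiN; lra.
Qed.

(** * Bounds on trade-off functions *)

Section tradeoff_bounds.
Context {R : realType} d (T : measurableType d) (P Q : probability T R).

Lemma tradeoff_le_indic (alpha : R) (A : set T) : measurable A ->
  (P A <= alpha%:E)%E -> (tradeoff P Q alpha <= 1 - Q A)%E.
Proof.
move=> mA PA; apply: ereal_inf_lbound; exists (\1_A : T -> R); last first.
  by rewrite expectation_indic.
split; first exact: measurable_indic.
- by move=> x; rewrite indicE; case: (_ \in _); rewrite /= ?lexx ?ler01.
- by rewrite expectation_indic.
Qed.

(** Passes to tests with extended real values, the form that integrating out coordinates
    produces. *)
Lemma le_tradeoff (alpha : R) (c : \bar R) :
  (forall f : T -> \bar R, measurable_fun setT f -> (forall x, 0 <= f x <= 1)%E ->
    (\int[P]_x f x <= alpha%:E)%E -> (c <= 1 - \int[Q]_x f x)%E) ->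
  (c <= tradeoff P Q alpha)%E.
Proof.
move=> H; apply/ereal_infP => _ [phi [mphi phi01 Pphi] <-].
rewrite unlock; apply: H.
- exact/measurable_EFinP.
- by move=> x; rewrite !lee_fin; exact: phi01.
- by move: Pphi; rewrite unlock.
Qed.

End tradeoff_bounds.

(** The half-line from [- s] upwards is a test of size [Phi s] and power [Phi (s + mu)]. *)
Lemma G_le_Phi {R : realType} (mu s : R) : (G mu (Phi s) <= (1 - Phi (s + mu))%:E)%E.
Proof.
rewrite /G EFinB.
have -> : (Phi (s + mu))%:E = normal_prob mu 1 `[- s, +oo[%classic.
  by rewrite normal_prob_cy opprK addrC.
apply: (@tradeoff_le_indic R _ _ (normal_prob 0 1) (normal_prob mu 1)) => //.
by rewrite [leLHS]normal_prob_cy sub0r opprK.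
Qed.

(** [Phi (- (mu / 2))] is the fixed point of [G mu]: the two densities cross at [mu / 2], so the
    likelihood-ratio test with threshold 1 has both errors equal to it. *)
Lemma Phi_le_G {R : realType} (mu a : R) : 0 <= mu -> a <= Phi (- (mu / 2)) ->
  ((Phi (- (mu / 2)))%:E <= G mu a)%E.
Proof.
move=> mu0 amu; apply: le_tradeoff => f mf f01 fa.
have : (\int[normal_prob mu 1]_x f x <= normal_prob mu 1 `[(mu / 2)%R, +oo[%classic)%E.
  apply: (neyman_pearson (normal_has_density 0 1) (normal_has_density mu 1) (k := 1)) => //.
  - move=> x /=; rewrite in_itv/= andbT => mx; rewrite mul1r [leRHS]normal_pdf_tilt.
    rewrite ler_peMl ?normal_pdf_ge0// -[leLHS]expR0 ler_expR.
    rewrite (_ : x * mu - mu ^+ 2 / 2 = mu * (x - mu / 2)); last by field.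
    by rewrite mulr_ge0// subr_ge0.
  - move=> x /=; rewrite in_itv/= andbT => /negP; rewrite -ltNge => mx.
    rewrite mul1r [leLHS]normal_pdf_tilt.
    rewrite ler_piMl ?normal_pdf_ge0// -[leRHS]expR0 ler_expR.
    rewrite (_ : x * mu - mu ^+ 2 / 2 = mu * (x - mu / 2)); last by field.
    by rewrite mulr_ge0_le0// subr_le0 ltW.
  - by rewrite [leRHS]normal_prob_cy sub0r (le_trans fa)// lee_fin.
rewrite normal_prob_cy (_ : mu - mu / 2 = - - (mu / 2)); last by field.
rewrite PhiN; case: (\int[_]_x f x)%E => [r| |]//.
  by rewrite !lee_fin; lra.
by move=> _; rewrite leey.
Qed.

(** * Privacy of the Laplace mechanism: sufficiency and necessity *)

Lemma l1dist_le_Delta1 {R : realType} (X : Type) n p (theta : n.-tuple X -> p.-tuple R)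
    (D : R) (S S' : n.-tuple X) :
  (Delta1 theta <= D%:E)%E -> neighbors S S' -> l1dist (theta S) (theta S') <= D.
Proof.
move=> hD SS'; rewrite -lee_fin; apply: le_trans hD.
by apply: ereal_sup_ubound; exists S, S'.
Qed.

Lemma GDP_M_Lap {R : realType} (X : Type) n p (theta : n.-tuple X -> p.-tuple R)
    (D mu : R) (b : {posnum R}) :
  (Delta1 theta <= D%:E)%E -> Phi (- (mu / 2)) <= lcdf (- (D / b%:num / 2)) ->
  GDP mu (M_Lap theta b).
Proof.
move=> hD hmu alpha /andP[a0 a1]; apply/ereal_infP => _ [S [S' [SS' ->]]].
apply: le_tradeoff => f mf f01 fa.
have Q01 : (0 <= \int[M_Lap theta b S']_x f x <= 1)%E by exact: integral01.
have [Q0 Q1] := andP Q01.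
(* The levels 0 and 1 are values of neither [lcdf] nor [Phi], so they are treated apart. *)
case: (eqVneq alpha 0) fa => [->|an0] fa.
  have -> : (\int[M_Lap theta b S']_x f x = 0)%E.
    apply/eqP; rewrite eq_le Q0 andbT.
    (* The size is at most [lcdf] of every point, however far to the left, so the power is at most
       every positive [e]. *)
    apply/lee_addgt0Pr => e e0; rewrite add0e.
    have [|x xe] := @lcdf_surj R (Num.min e 2^-1).
      by rewrite lt_min e0 invr_gt0 ltr0n/= gt_min invf_lt1 ?ltr1n ?orbT.
    apply: (@le_trans _ _ (lcdf x)%:E); last by rewrite xe lee_fin ge_min lexx.
    rewrite -(subrK (l1dist (theta S) (theta S') / b%:num) x).
    apply: M_Lap_test_shift => //; apply: (le_trans fa).
    by rewrite lee_fin lcdf_nonneg.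
  rewrite sube0; apply: (@le_trans _ _ (1 - normal_prob mu 1 set0)%E).
    by apply: tradeoff_le_indic => //; rewrite measure0.
  by rewrite measure0 sube0.
case: (eqVneq alpha 1) fa => [->|an1] fa.
  apply: (@le_trans _ _ (1 - normal_prob mu 1 setT)%E).
    by apply: tradeoff_le_indic => //; rewrite probability_setT.
  have -> : normal_prob mu 1 setT = 1%E by exact: probability_setT.
  by rewrite subee// subre_ge0.
have a01 : 0 < alpha < 1 by rewrite !lt_neqAle eq_sym an0 a0 an1 a1.
have [x xa] := lcdf_surj a01; have [s sa] := Phi_surj a01.
rewrite -xa in fa; rewrite -{1}sa.
apply: (le_trans (G_le_Phi mu s)).
(* The existence of a neighboring pair forces this. *)
have D0 : 0 <= D.
  by apply: le_trans (l1dist_le_Delta1 hD SS'); apply: sumr_ge0 => i _.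
have Db : 0 <= D / b%:num by rewrite divr_ge0.
have := lcdf_Phi_shift Db hmu (etrans sa (esym xa)).
have := M_Lap_test_shift S' mf f01 fa.
have : lcdf (x + l1dist (theta S) (theta S') / b%:num) <= lcdf (x + D / b%:num).
  by apply: lcdf_homo; rewrite lerD2l ler_pM2r ?invr_gt0// l1dist_le_Delta1.
case: (\int[M_Lap theta b S']_x f x)%E Q01 => [r| |]//=; rewrite ?leye_eq ?andbF//.
by rewrite -EFinB !lee_fin => _; lra.
Qed.

Lemma M_Lap_first_coord {R : realType} (X : Type) n p (theta : n.-tuple X -> p.+1.-tuple R)
    (b : {posnum R}) (S : n.-tuple X) (r : R) :
  M_Lap theta b S [set v | r <= tnth v ord0] =
  (lcdf ((tnth (theta S) ord0 - r) / b%:num))%:E.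
Proof.
(* The half-space is a box constraining the first coordinate only, so the product formula leaves a
   single Laplace factor. *)
pose A (i : 'I_p.+1) : set (measurableTypeR R) :=
  if i == ord0 then `[r - tnth (theta S) ord0, +oo[%classic else setT.
have mA i : measurable (A i) by rewrite /A; case: ifP.
have E : add_tuple (theta S) @^-1` [set v | r <= tnth v ord0] =
    [set v | forall i, A i (tnth v i)].
  apply/seteqP; split => v /=; rewrite tnth_mktuple.
    move=> rv i; rewrite /A; case: eqP => // ->.
    by rewrite /= in_itv/= andbT lerBlDl.
  by move=> /(_ ord0); rewrite /A eqxx /= in_itv/= andbT lerBlDl.
transitivity (Lap_p [tuple 0 | _ < p.+1] b [set v | forall i, A i (tnth v i)]).
  by rewrite -E.
rewrite /Lap_p product_law_box// big_ord_recl big1 ?mule1.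
  by rewrite /A eqxx [LHS]laplace_prob_cy tnth_mktuple sub0r opprB.
by move=> i _; rewrite /A/= probability_setT.
Qed.

(** For a statistic that jumps by [D] in one coordinate, the test at [D / 2] has both errors equal
    to the right-hand side [a]. Were [a] below the fixed point of [G mu], then [G mu a] would exceed
    [a], against privacy. *)
Lemma GDP_necessary {R : realType} (X : Type) n p (D mu : R) (b : {posnum R}) :
  (exists x y : X, x <> y) -> 0 <= D -> 0 <= mu ->
  (forall theta : n.+1.-tuple X -> p.+1.-tuple R,
     (Delta1 theta <= D%:E)%E -> GDP mu (M_Lap theta b)) ->
  Phi (- (mu / 2)) <= lcdf (- (D / b%:num / 2)).
Proof.
move=> [x0 [y0 xy]] D0 mu0 H.
(* Only the first coordinate varies, according to whether the first record equals [x0], so two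
   values are at distance 0 or [D]. *)
pose theta (S : n.+1.-tuple X) : p.+1.-tuple R :=
  [tuple if (i == ord0) && ~~ `[< tnth S ord0 = x0 >] then D else 0 | i < p.+1].
pose S := [tuple x0 | _ < n.+1].
pose S' := [tuple if i == ord0 then y0 else x0 | i < n.+1].
have Sx : tnth (theta S) ord0 = 0.
  by rewrite !tnth_mktuple eqxx/=; case: asboolP.
have S'x : tnth (theta S') ord0 = D.
  by rewrite !tnth_mktuple !eqxx/=; case: asboolP => // /esym.
have SS' : neighbors S S'.
  exists ord0; split => [|i]; first by rewrite !tnth_mktuple eqxx.
  by rewrite !tnth_mktuple; case: eqP.
have dtheta : (Delta1 theta <= D%:E)%E.
  apply: ge_ereal_sup => _ [T [T' [_ ->]]]; rewrite lee_fin /l1dist.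
  rewrite (bigD1 ord0)//= big1 ?addr0; last first.
    by move=> i /negbTE i0; rewrite !tnth_mktuple i0 subrr normr0.
  rewrite !tnth_mktuple eqxx /=; case: ifP => _; case: ifP => _;
    by rewrite ?subrr ?subr0 ?sub0r ?normrN ?normr0 ?ger0_norm.
rewrite leNgt; apply/negP => lt; set a := lcdf _ in lt.
have a0 : 0 <= a.
  by rewrite /a lcdf_le0 ?oppr_le0 ?divr_ge0// expR_ge0.
have a1 : a <= 1.
  rewrite (le_trans (ltW lt))// -lee_fin PhiE; exact: probability_le1.
have := H theta dtheta a; rewrite a0 a1 => /(_ isT).
move/ereal_infP/(_ (tradeoff (M_Lap theta b S) (M_Lap theta b S') a)).
have mB : measurable [set v : p.+1.-tuple (measurableTypeR R) | D / 2 <= tnth v ord0 :> R].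
  have := @measurable_tnth _ (measurableTypeR R) p.+1 ord0 measurableT `[D / 2, +oo[%classic.
  rewrite setTI => /(_ (measurable_itv _)); congr measurable.
  by apply/seteqP; split => v /=; rewrite in_itv/= andbT.
move=> /(_ (ex_intro _ S (ex_intro _ S' (conj SS' erefl)))) G1.
have : (G mu a <= 1 - M_Lap theta b S' [set v | (D / 2 <= tnth v ord0 :> R)%R])%E.
  apply: (le_trans G1); apply: tradeoff_le_indic => //.
  rewrite M_Lap_first_coord Sx lee_fin /a.
  by rewrite (_ : (0 - D / 2) / b%:num = - (D / b%:num / 2)) //; field.
rewrite M_Lap_first_coord S'x.
rewrite (_ : (D - D / 2) / b%:num = - - (D / b%:num / 2)); last by field.
rewrite lcdfN -/a => G2.
have := le_trans (Phi_le_G mu0 (ltW lt)) G2.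
by rewrite -EFinB lee_fin; lra.
Qed.

Lemma GDP_M_Lap_iff {R : realType} (X : Type) n p (D mu : R) (b : {posnum R}) :
  (exists x y : X, x <> y) -> (1 <= n)%N -> (1 <= p)%N -> 0 <= D -> 0 <= mu ->
  (forall theta : n.-tuple X -> p.-tuple R,
     (Delta1 theta <= D%:E)%E -> GDP mu (M_Lap theta b)) <->
  Phi (- (mu / 2)) <= lcdf (- (D / b%:num / 2)).
Proof.
case: n => // n; case: p => // p hX _ _ D0 mu0; split; first exact: GDP_necessary.
by move=> H theta hD; exact: GDP_M_Lap hD H.
Qed.

(** * The explicit thresholds and the theorem *)

Lemma lcdf_half {R : realType} (D : R) (b : {posnum R}) : 0 < D ->
  lcdf (- (D / b%:num / 2)) = 2^-1 * expR (- D / (2 * b%:num)).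
Proof.
move=> D0; rewrite lcdf_le0 ?oppr_le0 ?divr_ge0 ?(ltW D0)// mulrC.
by congr (_ * expR _); field.
Qed.

Lemma Phi_invK {R : realType} (a : R) : 0 < a < 1 -> Phi (Phi_inv a) = a.
Proof.
by move=> /Phi_surj[x <-]; apply: pinvK; rewrite inE; exists x.
Qed.

(** Taking logarithms makes the condition linear in [D / b]; the denominator in [b_mu] is positive
    because [Phi (- (mu / 2))] is below 1/2. *)
Lemma b_mu_le {R : realType} (D mu : R) (b : {posnum R}) : 0 < D -> 0 < mu ->
  (b_mu D mu <= b%:num) = (Phi (- (mu / 2)) <= lcdf (- (D / b%:num / 2))).
Proof.
move=> D0 mu0; rewrite lcdf_half//.
have q0 := @Phi_gt0 R (- (mu / 2)).
have q2 : Phi (- (mu / 2)) < 2^-1 by rewrite -[ltRHS]Phi0 Phi_lt; lra.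
have l0 : ln (2 * Phi (- (mu / 2))) < 0 by rewrite ln_lt0//; apply/andP; split; lra.
have -> : (Phi (- (mu / 2)) <= 2^-1 * expR (- D / (2 * b%:num))) =
    (ln (2 * Phi (- (mu / 2))) <= - D / (2 * b%:num)).
  by rewrite -[in RHS]ler_expR lnK ?posrE ?mulr_gt0//; apply/idP/idP => ?; lra.
rewrite /b_mu ler_pdivrMr; last by lra.
by rewrite ler_pdivlMr ?mulr_gt0//; apply/idP/idP => ?; lra.
Qed.

Lemma b_mu_gt0 {R : realType} (D mu : R) : 0 < D -> 0 < mu -> 0 < b_mu D mu.
Proof.
move=> D0 mu0; have q0 := @Phi_gt0 R (- (mu / 2)).
have q2 : Phi (- (mu / 2)) < 2^-1 by rewrite -[ltRHS]Phi0 Phi_lt; lra.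
have l0 : ln (2 * Phi (- (mu / 2))) < 0 by rewrite ln_lt0//; apply/andP; split; lra.
by rewrite divr_gt0//; lra.
Qed.

Theorem theorem13 (R : realType) (X : Type) (n p : nat) (D : R)
    (hX : exists x y : X, x <> y) (hn : (1 <= n)%N) (hp : (1 <= p)%N)
    (hD : 0 < D) :
  [/\
    forall (mu : R) (b : {posnum R}), 0 < mu ->
      (forall theta : n.-tuple X -> p.-tuple R,
         (Delta1 theta <= D%:E)%E -> GDP mu (M_Lap theta b)) <->
      b_mu D mu <= b%:num,
    forall (b : {posnum R}) (mu : R), 0 <= mu ->
      (forall theta : n.-tuple X -> p.-tuple R,
         (Delta1 theta <= D%:E)%E -> GDP mu (M_Lap theta b)) <->
      - 2 * Phi_inv (2^-1 * expR (- D / (2 * b%:num))) <= mu &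
    (2 <= p)%N -> forall mu : R, 0 < mu ->
      (forall theta : n.-tuple X -> p.-tuple R, (Delta1 theta <= D%:E)%E ->
         forall b : {posnum R}, b_mu D mu <= b%:num ->
           GDP mu (M_Lap theta b)) /\
      (exists theta : n.-tuple X -> p.-tuple R,
         (Delta1 theta <= D%:E)%E /\
         exists b : {posnum R}, b%:num < b_mu D mu /\
           GDP mu (M_Lap theta b))].
Proof.
split.
- move=> mu b mu0; rewrite b_mu_le//.
  exact: GDP_M_Lap_iff hX hn hp (ltW hD) (ltW mu0).
- move=> b mu mu0; apply: (iff_trans (GDP_M_Lap_iff b hX hn hp (ltW hD) mu0)).
  rewrite lcdf_half//; set a := 2^-1 * _.
  have a01 : 0 < a < 1.
    have : expR (- D / (2 * b%:num)) <= 1.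
      by rewrite -expR0 ler_expR mulNr oppr_le0 divr_ge0// ltW.
    by have := expR_gt0 (- D / (2 * b%:num)); rewrite /a; lra.
  (* As [a] lies in the range of [Phi], it can be written as a value of [Phi], and monotonicity
     compares the arguments. *)
  by rewrite -{1}(Phi_invK a01) Phi_le; split; lra.
- move=> _ mu mu0; split => [theta htheta b|].
    by rewrite b_mu_le//; exact: GDP_M_Lap.
  have b0 := b_mu_gt0 hD mu0.
  (* A constant statistic has sensitivity 0, so half of [b_mu D mu] can serve as a scale below the
     threshold. *)
  pose theta (_ : n.-tuple X) : p.-tuple R := [tuple 0 | _ < p].
  have htheta (c : R) : 0 <= c -> (Delta1 theta <= c%:E)%E.
    move=> c0; apply: ge_ereal_sup => _ [S [S' [_ ->]]].
    by rewrite lee_fin /l1dist big1// => i _; rewrite subrr normr0.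
  exists theta; split; first exact/htheta/ltW.
  have bh : 0 < b_mu D mu / 2 by rewrite divr_gt0.
  exists (PosNum bh); split => /=; first by lra.
  (* With sensitivity bound 0 the privacy condition reads [Phi (- (mu / 2)) <= lcdf 0], and [lcdf 0]
     is 1/2. *)
  apply: (@GDP_M_Lap _ _ _ _ _ 0 _ _ (htheta 0 (lexx 0))).
  by rewrite !mul0r oppr0 lcdf_le0// expR0 mul1r -[leRHS]Phi0 Phi_le; lra.
Qed.
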